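(* Let $\mathcal{C}$ be a symmetric strict monoidal category. There is an isomorphism of categories $$\pi_{0^*}(\mathbf{2}\text{-}\mathbf{Optic}(\mathcal{C})) \cong \mathbf{Optic}(\mathcal{C}),$$ where $\pi_{0^*} : \mathbf{2}\text{-}\mathbf{Cat} \to \mathbf{Cat}$ is the enriched base change along the connected components functor $\pi_0 : \mathbf{Cat} \to \mathbf{Set}$.
   Context: Composition is written in diagrammatic order: for $f : A \to B$ and $g : B \to C$, $f ; g : A \to C$. An object is used to denote its identity morphism, e.g. $r \otimes B$ means $r \otimes \mathrm{id}_B$. Symmetric strict monoidal means that associators and unitors are identities (the symmetry need not be); $I$ is the monoidal unit. Connected components: $\pi_0 : \mathbf{Cat} \to \mathbf{Set}$ sends a category to its set of objects modulo the equivalence relation identifying objects connected by a zigzag of morphisms. It preserves finite products. The base change $\pi_{0^*}$ sends a 2-category to the category with the same objects whose hom-sets are obtained by applying $\pi_0$ to the hom-categories, with the induced composition and identities. The 2-category $\mathbf{2}\text{-}\mathbf{Optic}(\mathcal{C})$: objects are pairs $(A,A')$ of objects of $\mathcal{C}$. A 1-cell $(A,A') \to (B,B')$ is a triple $(M, \mathsf{fw}, \mathsf{bw})$ with $M$ an object of $\mathcal{C}$, $\mathsf{fw} : A \to M \otimes B$ and $\mathsf{bw} : M \otimes B' \to A'$. A 2-cell $(M_1, \mathsf{fw}_1, \mathsf{bw}_1) \Rightarrow (M_2, \mathsf{fw}_2, \mathsf{bw}_2)$ is a morphism $r : M_1 \to M_2$ of $\mathcal{C}$ such that $\mathsf{fw}_1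 ; (r \otimes B) = \mathsf{fw}_2$ and $(r \otimes B') ; \mathsf{bw}_2 = \mathsf{bw}_1$; vertical composition and identities are those of $\mathcal{C}$. The composite of $(M_1, \mathsf{fw}_1, \mathsf{bw}_1) : (A,A') \to (B,B')$ and $(M_2, \mathsf{fw}_2, \mathsf{bw}_2) : (B,B') \to (C,C')$ is $$\bigl(M_1 \otimes M_2,\ \mathsf{fw}_1 ; (M_1 \otimes \mathsf{fw}_2),\ (M_1 \otimes \mathsf{bw}_2) ; \mathsf{bw}_1\bigr),$$ horizontal composition of 2-cells $r$, $s$ is $r \otimes s$, and the identity 1-cell on $(A,A')$ is $(I, \mathrm{id}_A, \mathrm{id}_{A'})$. The category $\mathbf{Optic}(\mathcal{C})$: objects are pairs $(A,A')$ of objects of $\mathcal{C}$. The hom-set from $(A,A')$ to $(B,B')$ is the coend $$\int^{M : \mathcal{C}} \mathcal{C}(A, M \otimes B) \times \mathcal{C}(M \otimes B', A'),$$ that is, the set of triples $(M, f, f')$ with $f : A \to M \otimes B$ and $f' : M \otimes B' \to A'$, modulo the equivalence relation generated by $(M, f, f') \sim (N, g, g')$ whenever there is $r : M \to N$ in $\mathcal{C}$ with $f ; (r \otimes B) = g$ and $(r \otimes B') ; g' = f'$. Composition and identities are given on representatives by the same formulas as for 1-cells of $\mathbf{2}\text{-}\mathbf{Optic}(\mathcal{C})$. *)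

(* Defs.v *)
From Stdlib Require Import Relations.
Set Warnings "-notation-overridden".
From mathcomp Require Import all_boot boolp.

Set Implicit Arguments.
Unset Strict Implicit.
Unset Printing Implicit Defensive.

Local Obligation Tactic := idtac.

Local Open Scope quotient_scope.

(* Quotient of [T] by the equivalence relation generated by [R].  [{classic T}]
   is [T] with the choiceType structure that [{eq_quot _}] asks for. *)

Section Quotient.
Variables (T : Type) (R : relation T).

Definition gen_rel : rel {classic T} := fun x y => `[< clos_refl_sym_trans T R x y >].

Lemma gen_rel_refl : reflexive gen_rel.
Proof. by move=> x; apply/asboolP; apply: rst_refl. Qed.

Lemma gen_rel_sym : symmetric gen_rel.
Proof. by move=> x y; apply/asboolP/asboolP; apply: rst_sym. Qed.

Lemma gen_rel_trans : transitive gen_rel.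
Proof. by move=> y x z /asboolP xy /asboolP yz; apply/asboolP; apply: rst_trans yz. Qed.

Canonical gen_equiv := EquivRel gen_rel gen_rel_refl gen_rel_sym gen_rel_trans.

Definition quot : Type := {eq_quot gen_equiv}.
Definition cls (x : T) : quot := \pi_{eq_quot gen_equiv} (x : {classic T}).
Definition rep (q : quot) : T := repr (q : {eq_quot gen_equiv}).

Lemma repK q : cls (rep q) = q.
Proof. exact: reprK. Qed.

Lemma clsP x y : cls x = cls y <-> clos_refl_sym_trans T R x y.
Proof.
split=> [e|e]; last by apply/eqquotP/asboolP.
by apply/asboolP; apply/(@eqquotP _ gen_equiv {eq_quot gen_equiv}).
Qed.

Lemma rep_cls x : clos_refl_sym_trans T R (rep (cls x)) x.
Proof. by apply/clsP; rewrite repK. Qed.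

Lemma cls_eq x y : R x y -> cls x = cls y.
Proof. by move=> xy; apply/clsP; apply: rst_step. Qed.

End Quotient.

Arguments cls {T} R x.
Arguments rep {T R} q.

Lemma clos_rst_map (T U : Type) (R : relation T) (S : relation U) (h : T -> U) :
  (forall x y, R x y -> S (h x) (h y)) ->
  forall x y, clos_refl_sym_trans T R x y -> clos_refl_sym_trans U S (h x) (h y).
Proof.
move=> hRS x y; elim=> {x y} [x y xy|x|x y _|x y z _ xy _ yz].
- by apply: rst_step; apply: hRS.
- exact: rst_refl.
- exact: rst_sym.
- exact: rst_trans yz.
Qed.

(* Categories, with composition in diagrammatic order *)

Record category := Category {
  obj :> Type;
  hom : obj -> obj -> Type;
  idm : forall x, hom x x;
  cmp : forall x y z, hom x y -> hom y z -> hom x z;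
  cmp1m : forall x y (f : hom x y), cmp (idm x) f = f;
  cmpm1 : forall x y (f : hom x y), cmp f (idm y) = f;
  cmpA : forall x y z t (f : hom x y) (g : hom y z) (h : hom z t),
    cmp f (cmp g h) = cmp (cmp f g) h
}.


Notation "f ;; g" := (cmp f g) (at level 50, left associativity).

(* The identity of [x], seen as a morphism into an object equal to [x] *)
Definition idto (C : category) (x y : C) (e : x = y) : hom x y :=
  match e in _ = z return hom x z with erefl => idm x end.

Record functor (C D : category) := Functor {
  fobj :> C -> D;
  fmap : forall x y : C, hom x y -> hom (fobj x) (fobj y);
  fmap1 : forall x, fmap (idm x) = idm (fobj x);
  fmapM : forall x y z (f : hom x y) (g : hom y z),
    fmap (f ;; g) = fmap f ;; fmap g
}.


Lemma idto_irr (C : category) (x y : C) (e e' : x = y) : idto e = idto e'.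
Proof. by congr idto; apply: Prop_irrelevance. Qed.

Lemma idto1 (C : category) (x : C) (e : x = x) : idto e = idm x.
Proof. exact: (idto_irr e erefl). Qed.

Lemma idtoM (C : category) (x y z : C) (e : x = y) (e' : y = z) :
  idto e ;; idto e' = idto (etrans e e').
Proof. by subst; rewrite /= cmp1m. Qed.

Lemma fmap_idto (C D : category) (F : functor C D) (x y : C) (e : x = y) :
  fmap F (idto e) = idto (f_equal F e).
Proof. by subst; rewrite /= fmap1. Qed.

Lemma functor_ext (C D : category) (F G : functor C D) :
  (exists e : forall x, F x = G x,
     forall x y (f : hom x y), fmap F f ;; idto (e y) = idto (e x) ;; fmap G f) -> F = G.
Proof.
case: F G => [F0 F1 F2 F3] [G0 G1 G2 G3] /= [e].
have E : F0 = G0 by apply: funext.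
subst G0 => H.
have E : F1 = G1.
  apply: functional_extensionality_dep => x; apply: functional_extensionality_dep => y.
  by apply: funext => f; move: (H x y f); rewrite !idto1 cmp1m cmpm1.
subst G1.
by congr Functor; apply: Prop_irrelevance.
Qed.

Lemma functor_eqO (C D : category) (F G : functor C D) (E : F = G) (x : C) : F x = G x.
Proof. by rewrite E. Qed.

Lemma functor_eqE (C D : category) (F G : functor C D) (E : F = G)
    (x y : C) (ex : F x = G x) (ey : F y = G y) (f : hom x y) :
  fmap F f ;; idto ey = idto ex ;; fmap G f.
Proof. by subst; rewrite !idto1 cmp1m cmpm1. Qed.

Definition functor_id (C : category) : functor C C :=
  @Functor C C (fun x => x) (fun _ _ f => f) (fun _ => erefl) (fun _ _ _ _ _ => erefl).

Program Definition functor_cmp (C D E : category) (F : functor C D) (G : functor D E) :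
    functor C E :=
  @Functor C E (fun x => G (F x)) (fun _ _ f => fmap G (fmap F f)) _ _.
Next Obligation. by move=> * /=; rewrite !fmap1. Qed.
Next Obligation. by move=> * /=; rewrite !fmapM. Qed.

Definition isomorphic (C D : category) : Prop :=
  exists (F : functor C D) (G : functor D C),
    functor_cmp F G = functor_id C /\ functor_cmp G F = functor_id D.

Program Definition terminal_cat : category :=
  @Category unit (fun _ _ => unit) (fun _ => tt) (fun _ _ _ _ _ => tt) _ _ _.
Next Obligation. by move=> x y []. Qed.
Next Obligation. by move=> x y []. Qed.
Next Obligation. by []. Qed.

Program Definition prod_cat (C D : category) : category :=
  @Category (C * D) (fun x y => (hom x.1 y.1 * hom x.2 y.2)%type)
    (fun x => (idm x.1, idm x.2)) (fun _ _ _ f g => (f.1 ;; g.1, f.2 ;; g.2)) _ _ _.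
Next Obligation. by move=> C D x y [f g] /=; rewrite !cmp1m. Qed.
Next Obligation. by move=> C D x y [f g] /=; rewrite !cmpm1. Qed.
Next Obligation. by move=> * /=; rewrite !cmpA. Qed.

Definition proj1_functor (C D : category) : functor (prod_cat C D) C :=
  @Functor (prod_cat C D) C (fun x => x.1) (fun _ _ f => f.1)
    (fun _ => erefl) (fun _ _ _ _ _ => erefl).

Definition proj2_functor (C D : category) : functor (prod_cat C D) D :=
  @Functor (prod_cat C D) D (fun x => x.2) (fun _ _ f => f.2)
    (fun _ => erefl) (fun _ _ _ _ _ => erefl).

Program Definition const_functor (C D : category) (d : D) : functor C D :=
  @Functor C D (fun _ => d) (fun _ _ _ => idm d) _ _.
Next Obligation. by []. Qed.
Next Obligation. by move=> * /=; rewrite cmp1m. Qed.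

Program Definition pair_functor (C D E : category) (F : functor C D) (G : functor C E) :
    functor C (prod_cat D E) :=
  @Functor C (prod_cat D E) (fun x => (F x, G x)) (fun _ _ f => (fmap F f, fmap G f)) _ _.
Next Obligation. by move=> * /=; rewrite !fmap1. Qed.
Next Obligation. by move=> * /=; rewrite !fmapM. Qed.

Definition prod_functor (C C' D D' : category) (F : functor C D) (F' : functor C' D') :
    functor (prod_cat C C') (prod_cat D D') :=
  pair_functor (functor_cmp (proj1_functor C C') F) (functor_cmp (proj2_functor C C') F').

Definition prod_assoc (C D E : category) :
    functor (prod_cat (prod_cat C D) E) (prod_cat C (prod_cat D E)) :=
  let P := proj1_functor (prod_cat C D) E in
  pair_functor (functor_cmp P (proj1_functor C D))
    (pair_functor (functor_cmp P (proj2_functor C D)) (proj2_functor (prod_cat C D) E)).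

(* Strict monoidal categories: the laws are equalities of functors, so on objects
   they are Leibniz equalities and on morphisms they hold up to [idto]. *)

Record strict_monoidal := StrictMonoidal {
  smcat :> category;
  tensor : functor (prod_cat smcat smcat) smcat;
  munit : smcat;
  tensor_assoc :
    functor_cmp (prod_functor tensor (functor_id smcat)) tensor =
    functor_cmp (prod_assoc smcat smcat smcat)
      (functor_cmp (prod_functor (functor_id smcat) tensor) tensor);
  tensor_unitl :
    functor_cmp (pair_functor (const_functor smcat munit) (functor_id smcat)) tensor =
    functor_id smcat;
  tensor_unitr :
    functor_cmp (pair_functor (functor_id smcat) (const_functor smcat munit)) tensor =
    functor_id smcat
}.

Arguments munit {s}.

Definition tens (C : strict_monoidal) (A B : C) : C := tensor C (A, B).
Definition tensm (C : strict_monoidal) (A A' B B' : C) (f : hom A A') (g : hom B B') :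
    hom (tens A B) (tens A' B') :=
  @fmap _ _ (tensor C) (A, B) (A', B') (f, g).

Notation "A ⊗ B" := (tens A B) (at level 40, left associativity).
Notation "f ⊗₁ g" := (tensm f g) (at level 40, left associativity).
Notation "f ▹ B" := (tensm f (idm B)) (at level 40, left associativity).
Notation "A ◃ f" := (tensm (idm A) f) (at level 40, left associativity).

Section StrictMonoidalTheory.
Variable C : strict_monoidal.

Lemma tensA (A B D : C) : (A ⊗ B) ⊗ D = A ⊗ (B ⊗ D).
Proof. exact: (functor_eqO (tensor_assoc C) (A, B, D)). Qed.

Lemma tens1l (A : C) : munit ⊗ A = A.
Proof. exact: (functor_eqO (tensor_unitl C) A). Qed.

Lemma tens1r (A : C) : A ⊗ munit = A.
Proof. exact: (functor_eqO (tensor_unitr C) A). Qed.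

Lemma tensm1 (A B : C) : idm A ⊗₁ idm B = idm (A ⊗ B).
Proof. exact: (@fmap1 _ _ (tensor C) (A, B)). Qed.

Lemma tensmM (A A' A'' B B' B'' : C) (f : hom A A') (f' : hom A' A'')
    (g : hom B B') (g' : hom B' B'') :
  (f ;; f') ⊗₁ (g ;; g') = (f ⊗₁ g) ;; (f' ⊗₁ g').
Proof. exact: (@fmapM _ _ (tensor C) (A, B) (A', B') (A'', B'') (f, g) (f', g')). Qed.

Lemma tensm_idto (A A' B B' : C) (e : A = A') (e' : B = B') :
  idto e ⊗₁ idto e' = idto (f_equal2 (@tens C) e e').
Proof. by subst; rewrite /= tensm1 idto1. Qed.

Lemma tensmA (A A' B B' D D' : C) (f : hom A A') (g : hom B B') (h : hom D D') :
  ((f ⊗₁ g) ⊗₁ h) ;; idto (tensA A' B' D') = idto (tensA A B D) ;; (f ⊗₁ (g ⊗₁ h)).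
Proof.
exact: (@functor_eqE _ _ _ _ (tensor_assoc C) (A, B, D) (A', B', D')
          (tensA A B D) (tensA A' B' D') (f, g, h)).
Qed.

Lemma tensm1l (A A' : C) (f : hom A A') :
  (munit ◃ f) ;; idto (tens1l A') = idto (tens1l A) ;; f.
Proof. exact: (functor_eqE (tensor_unitl C) (tens1l A) (tens1l A') f). Qed.

Lemma tensm1r (A A' : C) (f : hom A A') :
  (f ▹ munit) ;; idto (tens1r A') = idto (tens1r A) ;; f.
Proof. exact: (functor_eqE (tensor_unitr C) (tens1r A) (tens1r A') f). Qed.

End StrictMonoidalTheory.

(* The unit law for the braiding follows from [braid_hexagon] and [braid_inv]. *)
Record symmetric_strict_monoidal := SymmetricStrictMonoidal {
  ssm :> strict_monoidal;
  braid : forall A B : ssm, hom (A ⊗ B) (B ⊗ A);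
  braid_nat : forall (A A' B B' : ssm) (f : hom A A') (g : hom B B'),
    (f ⊗₁ g) ;; braid A' B' = braid A B ;; (g ⊗₁ f);
  braid_inv : forall A B : ssm, braid A B ;; braid B A = idm (A ⊗ B);
  braid_hexagon : forall A B D : ssm,
    idto (tensA A B D) ;; braid A (B ⊗ D) ;; idto (tensA B D A) =
    (braid A B ▹ D) ;; idto (tensA B A D) ;; (B ◃ braid A D)
}.

(* Strict 2-categories, as categories enriched in categories *)

Record two_category := TwoCategory {
  tobj :> Type;
  thom : tobj -> tobj -> category;
  tid : forall a, functor terminal_cat (thom a a);
  tcmp : forall a b c, functor (prod_cat (thom a b) (thom b c)) (thom a c);
  tcmp1m : forall a b,
    functor_cmp (pair_functor (const_functor (thom a b) (tid a tt)) (functor_id (thom a b)))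
      (tcmp a a b) = functor_id (thom a b);
  tcmpm1 : forall a b,
    functor_cmp (pair_functor (functor_id (thom a b)) (const_functor (thom a b) (tid b tt)))
      (tcmp a b b) = functor_id (thom a b);
  tcmpA : forall a b c d,
    functor_cmp (prod_functor (tcmp a b c) (functor_id (thom c d))) (tcmp a c d) =
    functor_cmp (prod_assoc (thom a b) (thom b c) (thom c d))
      (functor_cmp (prod_functor (functor_id (thom a b)) (tcmp b c d)) (tcmp a b d))
}.

Definition arrow_rel (C : category) : relation C := fun x y => inhabited (hom x y).
Definition pi0 (C : category) : Type := quot (@arrow_rel C).
Definition component (C : category) (x : C) : pi0 C := cls (@arrow_rel C) x.

Definition pi0_map (C D : category) (F : functor C D) (q : pi0 C) : pi0 D :=
  component (F (rep q)).

(* The comparison maps of the product-preserving functor [pi0] *)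
Definition pi0_unit (_ : unit) : pi0 terminal_cat := @component terminal_cat tt.
Definition pi0_prod (C D : category) (q : pi0 C * pi0 D) : pi0 (prod_cat C D) :=
  @component (prod_cat C D) (rep q.1, rep q.2).

Lemma pi0_mapE (C D : category) (F : functor C D) (x : C) :
  pi0_map F (component x) = component (F x).
Proof.
apply/clsP; apply: (clos_rst_map (h := F)) (rep_cls _ _) => {}x y [f].
by constructor; apply: (fmap F f).
Qed.

Lemma pi0_prodE (C D : category) (x : C) (y : D) :
  pi0_prod (component x, component y) = @component (prod_cat C D) (x, y).
Proof.
apply/clsP; apply: (rst_trans _ _ _ (x, rep (component y))).
  apply: (clos_rst_map (h := fun z : C => (z, rep (component y)) : prod_cat C D))
    (rep_cls _ _) => u v [f].
  by constructor; apply: (f, idm _).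
apply: (clos_rst_map (h := fun z : D => (x, z) : prod_cat C D)) (rep_cls _ _) => u v [f].
by constructor; apply: (idm _, f).
Qed.

Lemma pi0_unitK q : pi0_unit tt = q.
Proof. by rewrite -[q]repK; case: (rep q). Qed.

Lemma pi0_prodK (C D : category) (q : pi0 (prod_cat C D)) :
  pi0_prod (pi0_map (proj1_functor C D) q, pi0_map (proj2_functor C D) q) = q.
Proof.
rewrite -[q]repK; case: (rep q) => x y.
by rewrite !(@pi0_mapE (prod_cat C D)) pi0_prodE.
Qed.

Lemma pi0_prod_proj (C D : category) (q : pi0 C * pi0 D) :
  (pi0_map (proj1_functor C D) (pi0_prod q), pi0_map (proj2_functor C D) (pi0_prod q)) = q.
Proof.
case: q => q r; rewrite -[q]repK -[r]repK pi0_prodE.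
by rewrite !(@pi0_mapE (prod_cat C D)).
Qed.

Lemma pi0_ind (C : category) (P : pi0 C -> Prop) :
  (forall x, P (component x)) -> forall q, P q.
Proof. by move=> H q; rewrite -[q]repK; apply: H. Qed.

Section BaseChange.
Variable B : two_category.

Definition bc_id (a : B) : pi0 (thom a a) := pi0_map (tid a) (pi0_unit tt).
Definition bc_cmp (a b c : B) (f : pi0 (thom a b)) (g : pi0 (thom b c)) : pi0 (thom a c) :=
  pi0_map (tcmp a b c) (pi0_prod (f, g)).

Lemma bc_idE a : bc_id a = component (tid a tt).
Proof. exact: pi0_mapE. Qed.

Lemma bc_cmpE a b c (f : thom a b) (g : thom b c) :
  bc_cmp (component f) (component g) = component (tcmp a b c (f, g)).
Proof. by rewrite /bc_cmp pi0_prodE pi0_mapE. Qed.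

Lemma bc_cmp1m a b (f : pi0 (thom a b)) : bc_cmp (bc_id a) f = f.
Proof.
elim/pi0_ind: f => f; rewrite bc_idE bc_cmpE.
by congr component; apply: (functor_eqO (tcmp1m a b) f).
Qed.

Lemma bc_cmpm1 a b (f : pi0 (thom a b)) : bc_cmp f (bc_id b) = f.
Proof.
elim/pi0_ind: f => f; rewrite bc_idE bc_cmpE.
by congr component; apply: (functor_eqO (tcmpm1 a b) f).
Qed.

Lemma bc_cmpA a b c d (f : pi0 (thom a b)) (g : pi0 (thom b c)) (h : pi0 (thom c d)) :
  bc_cmp f (bc_cmp g h) = bc_cmp (bc_cmp f g) h.
Proof.
elim/pi0_ind: f => f; elim/pi0_ind: g => g; elim/pi0_ind: h => h; rewrite !bc_cmpE.
by congr component; apply: (functor_eqO (esym (tcmpA a b c d)) (f, g, h)).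
Qed.

Definition pi0_base_change : category := Category bc_cmp1m bc_cmpm1 bc_cmpA.

End BaseChange.

Section Optics.
Variable C : symmetric_strict_monoidal.

Implicit Types X Y Z W : (C * C)%type.

Record optic_triple X Y := OpticTriple {
  res : C;
  fw : hom X.1 (res ⊗ Y.1);
  bw : hom (res ⊗ Y.2) X.2
}.

Definition optic2_law X Y (p q : optic_triple X Y) (r : hom (res p) (res q)) : Prop :=
  fw p ;; (r ▹ Y.1) = fw q /\ (r ▹ Y.2) ;; bw q = bw p.

(* The morphisms [idto _] mediate the strict equalities of objects
   [(M1 ⊗ M2) ⊗ C = M1 ⊗ (M2 ⊗ C)] and [munit ⊗ A = A]. *)
Definition optic_triple_id X : optic_triple X X :=
  OpticTriple (idto (esym (tens1l X.1))) (idto (tens1l X.2)).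

Definition optic_triple_cmp X Y Z (p : optic_triple X Y) (q : optic_triple Y Z) :
    optic_triple X Z :=
  OpticTriple
    (fw p ;; (res p ◃ fw q) ;; idto (esym (tensA (res p) (res q) Z.1)))
    (idto (tensA (res p) (res q) Z.2) ;; (res p ◃ bw q) ;; bw p).

Lemma optic_triple_ext X Y (p q : optic_triple X Y) (e : res p = res q) :
  optic2_law (idto e) -> p = q.
Proof.
case: p q e => [M f b] [N g c] /= e; subst N; case=> /=.
by rewrite !tensm1 cmpm1 cmp1m => -> ->.
Qed.

Lemma optic2_law_id X Y (p : optic_triple X Y) : optic2_law (p := p) (q := p) (idm (res p)).
Proof. by split; rewrite tensm1 ?cmpm1 ?cmp1m. Qed.

Lemma optic2_law_cmp X Y (p q s : optic_triple X Y)
    (u : hom (res p) (res q)) (v : hom (res q) (res s)) :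
  optic2_law u -> optic2_law v -> optic2_law (p := p) (q := s) (u ;; v).
Proof.
case=> u1 u2 [v1 v2].
have E (A : C) : (u ;; v) ▹ A = (u ▹ A) ;; (v ▹ A) by rewrite -tensmM cmpm1.
by split; rewrite E; [rewrite cmpA u1 v1 | rewrite -cmpA v2 u2].
Qed.

Lemma tensAV_nat (A A' B B' D D' : C) (f : hom A A') (g : hom B B') (h : hom D D') :
  (f ⊗₁ (g ⊗₁ h)) ;; idto (esym (tensA A' B' D')) =
  idto (esym (tensA A B D)) ;; ((f ⊗₁ g) ⊗₁ h).
Proof.
have := f_equal (fun k => idto (esym (tensA A B D)) ;; k ;; idto (esym (tensA A' B' D')))
  (tensmA f g h).
rewrite !cmpA idtoM (idto1 (etrans _ _)) cmp1m => <-.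
by rewrite -!cmpA idtoM idto1 cmpm1.
Qed.

Lemma optic2_law_tens X Y Z (p p' : optic_triple X Y) (q q' : optic_triple Y Z)
    (u : hom (res p) (res p')) (v : hom (res q) (res q')) :
  optic2_law u -> optic2_law v ->
  optic2_law (p := optic_triple_cmp p q) (q := optic_triple_cmp p' q') (u ⊗₁ v).
Proof.
case=> u1 u2 [v1 v2]; split=> /=.
  rewrite -[LHS]cmpA -tensAV_nat -u1 -v1 !cmpA; congr (_ ;; _).
  by rewrite -!cmpA -!tensmM !cmp1m !cmpm1.
rewrite !cmpA tensmA -u2 -v2 -!cmpA; congr (_ ;; _).
by rewrite !cmpA -!tensmM !cmp1m !cmpm1.
Qed.

Lemma optic_triple_cmp1m_law X Y (p : optic_triple X Y) :
  optic2_law (p := optic_triple_cmp (optic_triple_id X) p) (q := p) (idto (tens1l (res p))).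
Proof.
have E (A B : C) (f : hom A B) :
    idto (esym (tens1l A)) ;; (munit ◃ f) = f ;; idto (esym (tens1l B)).
  have := f_equal (fun k => idto (esym (tens1l A)) ;; k ;; idto (esym (tens1l B))) (tensm1l f).
  by rewrite !cmpA idtoM (idto1 (etrans _ _)) cmp1m => <-; rewrite -!cmpA idtoM idto1 cmpm1.
split=> /=.
  by rewrite E -(idto1 erefl) tensm_idto -!cmpA !idtoM idto1 cmpm1.
rewrite -cmpA tensm1l !cmpA; congr (_ ;; _).
by rewrite -(idto1 erefl) tensm_idto idtoM; apply: idto_irr.
Qed.

Lemma optic_triple_cmpm1_law X Y (p : optic_triple X Y) :
  optic2_law (p := optic_triple_cmp p (optic_triple_id Y)) (q := p) (idto (tens1r (res p))).
Proof.
split=> /=; rewrite -!(idto1 erefl) !tensm_idto.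
  by rewrite -!cmpA !idtoM idto1 cmpm1.
by rewrite !idtoM; congr (_ ;; _); apply: idto_irr.
Qed.

Lemma optic_triple_cmpA_law X Y Z W (p : optic_triple X Y) (q : optic_triple Y Z)
    (s : optic_triple Z W) :
  optic2_law (p := optic_triple_cmp (optic_triple_cmp p q) s)
    (q := optic_triple_cmp p (optic_triple_cmp q s))
    (idto (tensA (res p) (res q) (res s))).
Proof.
have El (M A B D : C) (f : hom A B) (g : hom B D) : M ◃ (f ;; g) = (M ◃ f) ;; (M ◃ g).
  by rewrite -tensmM cmpm1.
split=> /=; rewrite !El -[idm (res p ⊗ res q)]tensm1.
  rewrite -!cmpA; congr (_ ;; (_ ;; _)).
  rewrite !cmpA -tensAV_nat -!cmpA; congr (_ ;; _).
  by rewrite -!(idto1 erefl) !tensm_idto !idtoM; apply: idto_irr.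
rewrite !cmpA; congr (_ ;; _ ;; _).
rewrite -[RHS]cmpA tensmA !cmpA; congr (_ ;; _).
by rewrite -!(idto1 erefl) !tensm_idto !idtoM; apply: idto_irr.
Qed.

Definition optic_triple_cmp1m X Y (p : optic_triple X Y) :=
  optic_triple_ext (optic_triple_cmp1m_law p).
Definition optic_triple_cmpm1 X Y (p : optic_triple X Y) :=
  optic_triple_ext (optic_triple_cmpm1_law p).
Definition optic_triple_cmpA X Y Z W (p : optic_triple X Y) (q : optic_triple Y Z)
    (s : optic_triple Z W) :=
  optic_triple_ext (optic_triple_cmpA_law p q s).

Record optic2 X Y (p q : optic_triple X Y) := Optic2 {
  two_cell :> hom (res p) (res q);
  two_cellP : optic2_law two_cell
}.

Lemma optic2_ext X Y (p q : optic_triple X Y) (u v : optic2 p q) :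
  two_cell u = two_cell v -> u = v.
Proof.
by case: u v => [u Pu] [v Pv] /= e; subst v; congr Optic2; apply: Prop_irrelevance.
Qed.

Program Definition optic_hom_cat X Y : category :=
  @Category (optic_triple X Y) (@optic2 X Y)
    (fun p => Optic2 (optic2_law_id p))
    (fun _ _ _ u v => Optic2 (optic2_law_cmp (two_cellP u) (two_cellP v))) _ _ _.
Next Obligation. by move=> * /=; apply: optic2_ext; rewrite /= cmp1m. Qed.
Next Obligation. by move=> * /=; apply: optic2_ext; rewrite /= cmpm1. Qed.
Next Obligation. by move=> * /=; apply: optic2_ext; rewrite /= cmpA. Qed.

Lemma two_cell_idto X Y (p q : optic_hom_cat X Y) (e : p = q) :
  two_cell (idto e) = idto (f_equal (@res X Y) e).
Proof. by subst. Qed.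

Definition two_optic_id X : functor terminal_cat (optic_hom_cat X X) :=
  const_functor terminal_cat (optic_triple_id X : optic_hom_cat X X).

Program Definition two_optic_cmp X Y Z :
    functor (prod_cat (optic_hom_cat X Y) (optic_hom_cat Y Z)) (optic_hom_cat X Z) :=
  @Functor (prod_cat (optic_hom_cat X Y) (optic_hom_cat Y Z)) (optic_hom_cat X Z)
    (fun p => optic_triple_cmp p.1 p.2)
    (fun _ _ u => Optic2 (optic2_law_tens (two_cellP u.1) (two_cellP u.2))) _ _.
Next Obligation. by move=> * /=; apply: optic2_ext; rewrite /= tensm1. Qed.
Next Obligation. by move=> * /=; apply: optic2_ext; rewrite /= tensmM. Qed.

Program Definition two_optic : two_category :=
  @TwoCategory (C * C)%type optic_hom_cat two_optic_id two_optic_cmp _ _ _.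
Next Obligation.
move=> X Y; apply: functor_ext; exists (fun p => optic_triple_cmp1m p) => p q u.
apply: optic2_ext; rewrite /= !two_cell_idto.
by rewrite (idto_irr _ (tens1l (res p))) (idto_irr _ (tens1l (res q))) tensm1l.
Qed.
Next Obligation.
move=> X Y; apply: functor_ext; exists (fun p => optic_triple_cmpm1 p) => p q u.
apply: optic2_ext; rewrite /= !two_cell_idto.
by rewrite (idto_irr _ (tens1r (res p))) (idto_irr _ (tens1r (res q))) tensm1r.
Qed.
Next Obligation.
move=> X Y Z W; apply: functor_ext.
exists (fun p => optic_triple_cmpA p.1.1 p.1.2 p.2) => p q u.
apply: optic2_ext; rewrite /= !two_cell_idto.
rewrite (idto_irr _ (tensA (res p.1.1) (res p.1.2) (res p.2))).
by rewrite (idto_irr _ (tensA (res q.1.1) (res q.1.2) (res q.2))) tensmA.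
Qed.

(* The hom-sets of [optic] are the coends over [M] of
   [hom X.1 (M ⊗ Y.1) * hom (M ⊗ Y.2) X.2]. *)

Definition coend_rel X Y : relation (optic_triple X Y) :=
  fun p q => exists r : hom (res p) (res q), optic2_law r.

Definition optic_coend X Y : Type := quot (@coend_rel X Y).
Definition optic_cls X Y (p : optic_triple X Y) : optic_coend X Y := cls (@coend_rel X Y) p.

Definition optic_id X : optic_coend X X := optic_cls (optic_triple_id X).
Definition optic_cmp X Y Z (f : optic_coend X Y) (g : optic_coend Y Z) : optic_coend X Z :=
  optic_cls (optic_triple_cmp (rep f) (rep g)).

Lemma optic_cmpE X Y Z (p : optic_triple X Y) (q : optic_triple Y Z) :
  optic_cmp (optic_cls p) (optic_cls q) = optic_cls (optic_triple_cmp p q).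
Proof.
apply/clsP; apply: (rst_trans _ _ _ (optic_triple_cmp p (rep (optic_cls q)))).
  apply: (clos_rst_map (h := fun s => optic_triple_cmp s (rep (optic_cls q))))
    (rep_cls _ _) => s t [r Hr].
  by exists (r ⊗₁ idm _); apply: optic2_law_tens Hr (optic2_law_id _).
apply: (clos_rst_map (h := fun s => optic_triple_cmp p s)) (rep_cls _ _) => s t [r Hr].
by exists (idm _ ⊗₁ r); apply: optic2_law_tens (optic2_law_id _) Hr.
Qed.

Lemma optic_cmp1m X Y (f : optic_coend X Y) : optic_cmp (optic_id X) f = f.
Proof. by rewrite -[f]repK [LHS]optic_cmpE optic_triple_cmp1m. Qed.

Lemma optic_cmpm1 X Y (f : optic_coend X Y) : optic_cmp f (optic_id Y) = f.
Proof. by rewrite -[f]repK [LHS]optic_cmpE optic_triple_cmpm1. Qed.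

Lemma optic_cmpA X Y Z W (f : optic_coend X Y) (g : optic_coend Y Z) (h : optic_coend Z W) :
  optic_cmp f (optic_cmp g h) = optic_cmp (optic_cmp f g) h.
Proof.
rewrite -[f]repK -[g]repK -[h]repK -!/(optic_cls _) !optic_cmpE.
by rewrite optic_triple_cmpA.
Qed.

Definition optic : category := Category optic_cmp1m optic_cmpm1 optic_cmpA.

End Optics.

(* Main.v *)
Require Import Defs.
From Stdlib Require Import Relations.
From mathcomp Require Import all_boot.

Set Implicit Arguments.
Unset Strict Implicit.
Unset Printing Implicit Defensive.

(* A 2-cell between optic triples is the same thing as a generator of the coend
   relation, so both hom-sets are quotients of the same set of triples by the same
   equivalence, and on representatives the two compositions agree. *)

Section Requotient.
Variables (T : Type) (R S : relation T).

(** Going through a chosen representative gives a total map for arbitrary [R] and [S]; it is the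
    canonical map of quotients once [R] is included in [S]. *)
Definition requot (q : quot R) : quot S := cls S (rep q).

(** The chosen representative of the class of [x] is joined to [x] by a zigzag of [R]-steps, each of
    which is also an [S]-step. *)
Lemma requotE (x : T) : inclusion T R S -> requot (cls R x) = cls S x.
Proof. by move=> RS; apply/clsP/(clos_rst_map (h := id) RS)/rep_cls. Qed.

End Requotient.

Lemma requotK (T : Type) (R S : relation T) :
  inclusion T R S -> inclusion T S R -> cancel (@requot T R S) (@requot T S R).
Proof. by move=> RS SR q; rewrite -[q]repK !requotE. Qed.

Section OpticComparison.
Variable C : symmetric_strict_monoidal.
Implicit Types X Y Z : (C * C)%type.

Notation B := (pi0_base_change (two_optic C)).

Lemma arrow_coend_rel X Y :
  inclusion (optic_triple X Y) (@arrow_rel (optic_hom_cat X Y)) (@coend_rel C X Y).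
Proof. by move=> p q [[r rP]]; exists r. Qed.

Lemma coend_arrow_rel X Y :
  inclusion (optic_triple X Y) (@coend_rel C X Y) (@arrow_rel (optic_hom_cat X Y)).
Proof. by move=> p q [r rP]; constructor; exists r. Qed.

Definition coend_of_pi0 X Y (q : pi0 (optic_hom_cat X Y)) : optic_coend X Y :=
  requot (@coend_rel C X Y) q.

Definition pi0_of_coend X Y (q : optic_coend X Y) : pi0 (optic_hom_cat X Y) :=
  requot (@arrow_rel (optic_hom_cat X Y)) q.

Lemma coend_of_pi0E X Y (p : optic_triple X Y) :
  coend_of_pi0 (@component (optic_hom_cat X Y) p) = optic_cls p.
Proof. exact/requotE/arrow_coend_rel. Qed.

Lemma coend_of_pi0K X Y : cancel (@coend_of_pi0 X Y) (@pi0_of_coend X Y).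
Proof. exact: requotK (@arrow_coend_rel X Y) (@coend_arrow_rel X Y). Qed.

Lemma pi0_of_coendK X Y : cancel (@pi0_of_coend X Y) (@coend_of_pi0 X Y).
Proof. exact: requotK (@coend_arrow_rel X Y) (@arrow_coend_rel X Y). Qed.

Lemma coend_of_pi0_id X : coend_of_pi0 (bc_id (B := two_optic C) X) = optic_id X.
Proof. by rewrite bc_idE coend_of_pi0E. Qed.

Lemma coend_of_pi0_cmp X Y Z
    (f : pi0 (optic_hom_cat X Y)) (g : pi0 (optic_hom_cat Y Z)) :
  coend_of_pi0 (bc_cmp (B := two_optic C) f g) =
  optic_cmp (coend_of_pi0 f) (coend_of_pi0 g).
Proof.
(* On classes of explicit triples, both sides become the class of the same
   [optic_triple_cmp f g]. *)
elim/pi0_ind: f => f; elim/pi0_ind: g => g.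
by rewrite (bc_cmpE (B := two_optic C)) !coend_of_pi0E optic_cmpE.
Qed.

Definition optic_of_pi0 : functor B (optic C) :=
  @Functor B (optic C) id coend_of_pi0 coend_of_pi0_id coend_of_pi0_cmp.

Lemma pi0_of_coend_id X : pi0_of_coend (optic_id X) = bc_id (B := two_optic C) X.
Proof. by rewrite -coend_of_pi0_id coend_of_pi0K. Qed.

(** An inverse of a composition-preserving bijection preserves composition. *)
Lemma pi0_of_coend_cmp X Y Z (f : optic_coend X Y) (g : optic_coend Y Z) :
  pi0_of_coend (optic_cmp f g) =
  bc_cmp (B := two_optic C) (pi0_of_coend f) (pi0_of_coend g).
Proof.
by rewrite -{1}[f]pi0_of_coendK -{1}[g]pi0_of_coendK -coend_of_pi0_cmp coend_of_pi0K.
Qed.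

Definition pi0_of_optic : functor (optic C) B :=
  @Functor (optic C) B id pi0_of_coend pi0_of_coend_id pi0_of_coend_cmp.

End OpticComparison.

Theorem proposition6 (C : symmetric_strict_monoidal) :
  isomorphic (pi0_base_change (two_optic C)) (optic C).
Proof.
exists (optic_of_pi0 C), (pi0_of_optic C).
(* Both functors fix objects, so the object equalities are [erefl] and their [idto] are identities;
   what remains is that the hom-set maps are mutually inverse. *)
split; apply: functor_ext; exists (fun=> erefl) => X Y f; rewrite cmpm1 cmp1m.
- exact: coend_of_pi0K.
- exact: pi0_of_coendK.
Qed.
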